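(* Let $\mathbf E=(E_x,E_y,E_z)$ and $\mathbf H=(H_x,H_y,H_z)$ be a ($C^2$ on $[0,T]\times\overline\Omega$) solution of the Maxwell equations in a lossless and isotropic medium, $$\varepsilon\,\frac{\partial \mathbf E}{\partial t}=\nabla\times\mathbf H,\qquad \mu\,\frac{\partial \mathbf H}{\partial t}=-\nabla\times\mathbf E\qquad\text{in }(0,T]\times\Omega ,$$ satisfying the perfectly electric conducting (PEC) boundary conditions $\vec n\times\mathbf E=0$ and $\vec n\cdot\mathbf H=0$ on $(0,T]\times\partial\Omega$. Then for each $w\in\{x,y,z\}$ the quantity $$\int_\Omega\left(\varepsilon\left|\frac{\partial\mathbf E}{\partial w}\right|^2+\mu\left|\frac{\partial\mathbf H}{\partial w}\right|^2\right)dx\,dy\,dz$$ is constant in time on $[0,T]$.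
   Context: $\Omega=[0,1]\times[0,1]\times[0,1]$ is the unit cube, $T>0$, and $\vec n$ is the outward unit normal of $\partial\Omega$. The electric permittivity $\varepsilon>0$ and the magnetic permeability $\mu>0$ are constants (lossless isotropic medium, zero conductivity, no source). $|\cdot|$ is the Euclidean norm in $\mathbb R^3$ and derivatives of vector fields are taken componentwise. The boundary condition $\vec n\times\mathbf E=0$, $\vec n\cdot\mathbf H=0$ is imposed on each open face of the cube; equivalently, $E_y=E_z=H_x=0$ for $x\in\{0,1\}$, $E_x=E_z=H_y=0$ for $y\in\{0,1\}$, and $E_x=E_y=H_z=0$ for $z\in\{0,1\}$. *)

(* Defs.v *)
From HB Require Import structures.
From mathcomp Require Import all_boot all_order all_algebra.
From mathcomp Require Import all_classical all_reals all_analysis.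

Set Implicit Arguments.
Unset Strict Implicit.
Unset Printing Implicit Defensive.

Import Order.TTheory GRing.Theory Num.Theory.
Import numFieldNormedType.Exports.

Local Open Scope classical_set_scope.
Local Open Scope ring_scope.

(* Points of space are triples rather than row vectors because the library has
   product measures on pairs, but no Lebesgue measure on 'rV[R]_3. *)
Notation space R := (R * R * R)%type.
Notation spacetime R := (R * space R)%type.

(* The indices 0, 1, 2 : 'I_3 stand for x, y, z, in arithmetic modulo 3. *)
Definition coord (R : realType) (X : space R) (i : 'I_3) : R :=
  [:: X.1.1; X.1.2; X.2]`_i.

Definition axis (R : realType) (i : 'I_3) : space R :=
  ((i == 0)%:R, (i == 1)%:R, (i == 2)%:R).

(* None is the direction of t, Some i the direction of the i-th space axis. *)
Definition dir (R : realType) (d : option 'I_3) : spacetime R :=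
  if d is Some i then (0, axis R i) else (1, 0).

Definition cube (R : realType) : set (space R) :=
  [set X | forall i, 0 <= coord X i <= 1].

Definition slab (R : realType) (T : R) : set (spacetime R) :=
  [set t | 0 <= t <= T] `*` @cube R.

Section relative_derivative.
Context {R : realType}.
Implicit Types (K : set (spacetime R)) (f : spacetime R -> R).

(* These are derivable and 'D_v of the library, except that the increments
   leading outside K are discarded: on a closed box K the derivatives at the
   boundary are one-sided, and the values of f outside K are irrelevant. *)
Definition rel_quotient K f (v p : spacetime R) : set_system R :=
  (fun h : R => h^-1 *: (f (p + h *: v) - f p))
    @ within [set h | K (p + h *: v)] 0^'.

Definition rel_derivable K f v p : Prop := cvg (rel_quotient K f v p).

Definition rel_derive K f v p : R := lim (rel_quotient K f v p).

Lemma rel_quotient_interior K f v p : K° p ->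
  rel_quotient K f v p = (fun h => h^-1 *: ((f \o shift p) (h *: v) - f p)) @ 0^'.
Proof.
move=> Kp; rewrite /rel_quotient.
have -> : within [set h : R | K (p + h *: v)] 0^' = 0^'.
  have Kh : \forall h \near 0^', K (p + h *: v).
    apply: nbhs_dnbhs.
    have: (fun h : R => p + h *: v) @ (0 : R) --> p + 0 *: v.
      by apply: cvgD; [exact: cvg_cst | apply: cvgZr_tmp; exact: cvg_id].
    by rewrite scale0r addr0; apply.
  apply/seteqP; split=> A HA; last by apply: filterS HA => h Ah _.
  by apply: filterS2 Kh HA => h Kh HA; exact: HA.
suff -> : (fun h : R => h^-1 *: (f (p + h *: v) - f p)) =
  (fun h => h^-1 *: ((f \o shift p) (h *: v) - f p)) by [].
by apply/funext => h /=; rewrite [p + _]addrC.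
Qed.

Lemma rel_derive_interior K f v p : K° p -> rel_derive K f v p = 'D_v f p.
Proof. by move=> Kp; rewrite /rel_derive rel_quotient_interior. Qed.

Lemma rel_derivable_interior K f v p : K° p ->
  rel_derivable K f v p = derivable f p v.
Proof. by move=> Kp; rewrite /rel_derivable rel_quotient_interior. Qed.

(* C^k on K, with the derivatives up to the boundary of K. *)
Fixpoint rel_Ck K (k : nat) f : Prop :=
  {within K, continuous f} /\
  (if k is k'.+1 then
    forall d, (forall p, K p -> rel_derivable K f (dir R d) p) /\
              rel_Ck K k' (rel_derive K f (dir R d))
  else True).

End relative_derivative.

Section vector_fields.
Context {R : realType}.
Implicit Types (T : R) (F E H : spacetime R -> 'rV[R]_3) (u v : 'rV[R]_3).

Definition enorm u : R := Num.sqrt (\sum_i u 0 i ^+ 2).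

Definition dot u v : R := \sum_i u 0 i * v 0 i.

Definition cross u v : 'rV[R]_3 :=
  \row_i (u 0 (i + 1) * v 0 (i + 2) - u 0 (i + 2) * v 0 (i + 1)).

Definition pder T (d : option 'I_3) F p : 'rV[R]_3 :=
  \row_i rel_derive (slab T) (fun q => F q 0 i) (dir R d) p.

Definition curl T F p : 'rV[R]_3 :=
  \row_i (pder T (Some (i + 1)) F p 0 (i + 2)
          - pder T (Some (i + 2)) F p 0 (i + 1)).

Definition C2_field T F : Prop :=
  forall i, rel_Ck (slab T) 2 (fun q => F q 0 i).

Definition maxwell (T eps mu : R) E H : Prop :=
  forall t X, 0 < t <= T -> (@cube R)° X ->
    eps *: pder T None E (t, X) = curl T H (t, X) /\
    mu *: pder T None H (t, X) = - curl T E (t, X).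

(* The open face of the cube in the plane x_i = b, for b = 0 or 1, and the
   outward unit normal there. *)
Definition face (i : 'I_3) (b : bool) : set (space R) :=
  [set X | coord X i = b%:R /\ forall j, j != i -> 0 < coord X j < 1].

Definition normal (i : 'I_3) (b : bool) : 'rV[R]_3 :=
  (if b then 1 else -1) *: delta_mx 0 i.

Definition PEC T E H : Prop :=
  forall t X i b, 0 < t <= T -> face i b X ->
    cross (normal i b) (E (t, X)) = 0 /\ dot (normal i b) (H (t, X)) = 0.

End vector_fields.

Notation lebesgue3 R :=
  (@lebesgue_measure R \x @lebesgue_measure R \x @lebesgue_measure R)%E.

(* Main.v *)
Require Import Defs.
From HB Require Import structures.
From mathcomp Require Import all_boot all_order all_algebra.
From mathcomp Require Import all_classical all_reals all_analysis.
From mathcomp Require Import ring lra.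
Import Order.TTheory GRing.Theory Num.Theory.
Import numFieldNormedType.Exports.
Local Open Scope classical_set_scope.
Local Open Scope ring_scope.

(** Differentiating Maxwell's equations along a fixed axis [w] gives Maxwell's
    equations for the pair (E', H') of the derivatives of E and H, by the symmetry of
    second derivatives ([clairaut], [pd_maxwell]). The quantity in the theorem is the
    electromagnetic energy of this pair, and Poynting's identity holds for it: the
    time derivative of eps |E'|^2 + mu |H'|^2 is the divergence of -2 E' x H'
    ([poynting_balance]).

    It remains to see that E' x H' has no flux through a face. Only the tangential
    components of E' and H' matter for its normal component. On a face tangent to [w],
    the tangential components of E vanish identically, so do their derivatives along
    [w]. On a face normal to [w] this argument fails, since the normal derivative of a
    tangential component of E is unconstrained. There it is H' that has zero
    tangential components. Indeed the tangential part of curl H is eps times the time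
    derivative of the tangential part of E, which is zero. It also equals, up to
    tangential derivatives of the normal component of H, which are zero, the tangential
    part of H' turned by a right angle ([PEC_normal_pd], [poynting_influx_face]).

    The balance is then integrated over time and the cube ([integral_conserved]).
    Since E and H are just C^2, the density and the flux are C^1 up to the boundary,
    and the fundamental theorem of calculus along each axis, with Fubini's theorem to
    put this axis first, gives that each term of the divergence has zero integral.
    Integrating in time as well, instead of differentiating the energy, leaves only
    integrals of continuous functions on a compact box.

    The equations and the boundary conditions are assumed for positive times, in the
    interior of the cube and on open faces. They are used on the whole closed box,
    to which they extend by continuity along segments ([eq_along_segment]). *)

(** * Arithmetic of the three axis indices *)

Lemma ord3_cases (i : 'I_3) : [\/ i = 0, i = 1 | i = 2].
Proof.
by case: i => [[|[|[|//]]] Hi]; [apply: Or31|apply: Or32|apply: Or33];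
  apply/val_inj.
Qed.

Lemma ord3_addE (i : 'I_3) : [/\ i + 1 + 1 = i + 2, i + 1 + 2 = i, i + 2 + 1 = i &
  i + 2 + 2 = i + 1].
Proof. by case: (ord3_cases i) => ->; split; exact/val_inj. Qed.

Lemma ord3_add_neq (i : 'I_3) : (i + 1 == i) = false /\ (i + 2 == i) = false.
Proof. by case: (ord3_cases i) => ->. Qed.

Lemma sum_ord3 (V : zmodType) (F : 'I_3 -> V) : \sum_i F i = F 0 + F 1 + F 2.
Proof.
rewrite !big_ord_recl big_ord0 addr0 addrA.
by congr (_ + F _ + F _); exact/val_inj.
Qed.

(** * Coordinates, and continuity up to the boundary of the slab *)

Section geometry.
Context {R : realType}.
Implicit Types (p q : spacetime R) (d e : option 'I_3) (T : R).

(** The time coordinate has index [None], like the direction of [t] in [dir]. *)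
Definition stcoord p d : R := if d is Some i then Defs.coord p.2 i else p.1.

Definition extent T d : R := if d is Some _ then 1 else T.

Definition set_coord p d (s : R) : spacetime R := p + (s - stcoord p d) *: dir R d.

Lemma stcoordD p q d : stcoord (p + q) d = stcoord p d + stcoord q d.
Proof. by case: d => [i|//]; case: (ord3_cases i) => ->. Qed.

Lemma stcoordN p d : stcoord (- p) d = - stcoord p d.
Proof. by case: d => [i|//]; case: (ord3_cases i) => ->. Qed.

Lemma stcoordZ (a : R) p d : stcoord (a *: p) d = a * stcoord p d.
Proof. by case: d => [i|//]; case: (ord3_cases i) => ->. Qed.

Lemma stcoord_dir d e : stcoord (dir R d) e = (e == d)%:R.
Proof.
case: d e => [i|] [j|] //=; last by case: (ord3_cases j) => ->.
by case: (ord3_cases j) => ->; case: (ord3_cases i) => ->.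
Qed.

Lemma stcoord_ext p q : (forall d, stcoord p d = stcoord q d) -> p = q.
Proof.
case: p q => [t [[x y] z]] [t' [[x' y'] z']] h.
by move: (h None) (h (Some 0)) (h (Some 1)) (h (Some 2));
  rewrite /stcoord /Defs.coord /= => -> -> -> ->.
Qed.

(** In this form time and space are treated alike: only the side length depends on
    the direction. *)
Lemma slabP T p : slab T p <-> forall d, 0 <= stcoord p d <= extent T d.
Proof.
split=> [[/= tp Xp] [i|//]|h]; first exact: Xp.
by split=> [|i]; [exact: (h None)|exact: (h (Some i))].
Qed.

Lemma stcoord_set p d s e :
  stcoord (set_coord p d s) e = if e == d then s else stcoord p e.
Proof.
rewrite stcoordD stcoordZ stcoord_dir; case: eqP => [->|_].
  by rewrite mulr1 addrC subrK.
by rewrite mulr0 addr0.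
Qed.

Lemma set_coord_slab T p d s : slab T p -> 0 <= s <= extent T d ->
  slab T (set_coord p d s).
Proof.
move=> /slabP Kp hs; apply/slabP => e; rewrite stcoord_set.
by case: eqP => [->|_].
Qed.

Lemma set_coord_id p d : set_coord p d (stcoord p d) = p.
Proof. by rewrite /set_coord subrr scale0r addr0. Qed.

Lemma set_coord_shift p d s h : set_coord p d s + h *: dir R d = set_coord p d (s + h).
Proof. by rewrite /set_coord -addrA -scalerDl addrAC. Qed.

Lemma set_coordC p d e s r : d != e ->
  set_coord (set_coord p d s) e r = set_coord (set_coord p e r) d s.
Proof.
move=> de; apply: stcoord_ext => a; rewrite !stcoord_set.
by case: (eqVneq a e) => [->|//]; rewrite eq_sym (negbTE de).
Qed.

Lemma stcoord_continuous d : continuous (stcoord ^~ d).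
Proof.
case: d => [i|] p /=; last exact: cvg_fst.
have c2 : (fun q : spacetime R => q.2) @ p --> p.2 by exact: cvg_snd.
have c21 : (fun q : spacetime R => q.2.1) @ p --> p.2.1.
  by apply: (cvg_comp _ _ c2); exact: cvg_fst.
case: (ord3_cases i) => -> /=.
- by apply: (cvg_comp _ _ c21); exact: cvg_fst.
- by apply: (cvg_comp _ _ c21); exact: cvg_snd.
- by apply: (cvg_comp _ _ c2); exact: cvg_snd.
Qed.

Lemma set_coord_continuous p d : continuous (set_coord p d).
Proof.
move=> s; apply: cvgD; first exact: cvg_cst.
by apply: cvgZr_tmp; apply: cvgB; [exact: cvg_id|exact: cvg_cst].
Qed.

(** The retraction of spacetime onto the slab. Composing with it turns a function
    that is only continuous on the slab into a globally continuous one, so that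
    measurability and boundedness need no care at the boundary. *)
Definition clamp T p : spacetime R :=
  let c L (x : R) := Num.max 0 (Num.min x L) in
  (c T p.1, ((c 1 p.2.1.1, c 1 p.2.1.2), c 1 p.2.2)).

Lemma stcoord_clamp T p d :
  stcoord (clamp T p) d = Num.max 0 (Num.min (stcoord p d) (extent T d)).
Proof. by case: d => [i|//]; case: (ord3_cases i) => ->. Qed.

Lemma extent_gt0 T d : 0 < T -> 0 < extent T d.
Proof. by case: d => //= *; exact: ltr01. Qed.

Lemma clamp_slab T p : 0 < T -> slab T (clamp T p).
Proof.
move=> T0; apply/slabP => d; rewrite stcoord_clamp.
have := extent_gt0 T d T0; rewrite le_max lexx/= ge_max ge_min lexx orbT andbT.
exact: ltW.
Qed.

Lemma clamp_id T p : slab T p -> clamp T p = p.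
Proof.
move=> /slabP Kp; apply: stcoord_ext => d; rewrite stcoord_clamp.
by have /andP[h1 h2] := Kp d; rewrite (min_idPl h2); apply/max_idPr.
Qed.

Lemma clamp_continuous T : continuous (clamp T).
Proof.
move=> p.
have c (L : R) (f : spacetime R -> R) : f @ p --> f p ->
    (fun q => Num.max 0 (Num.min (f q) L)) @ p --> Num.max 0 (Num.min (f p) L).
  move=> fp.
  apply: (@continuous_max _ _ (cst 0) (fun q => Num.min (f q) L)); first exact: cvg_cst.
  by apply: (@continuous_min _ _ f (cst L)) => //; exact: cvg_cst.
have cP (A B : topologicalType) (f : spacetime R -> A) (g : spacetime R -> B) :
    f @ p --> f p -> g @ p --> g p ->
    (fun q => (f q, g q)) @ p --> (f p, g p).
  by move=> fp gp; exact: cvg_pair.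
have h L d : (fun q => Num.max 0 (Num.min (stcoord q d) L)) @ p -->
    Num.max 0 (Num.min (stcoord p d) L) by apply: c; exact: stcoord_continuous.
exact: cP _ _ _ _ (h T None)
  (cP _ _ _ _ (cP _ _ _ _ (h 1 (Some 0)) (h 1 (Some 1))) (h 1 (Some 2))).
Qed.

(** Continuity within the slab, in the form in which it is applied: limits may be
    taken along any filter that eventually stays in the slab. *)
Lemma cvg_within_slab {U : Type} {F : set_system U} {FF : Filter F} (T : R)
   (f : spacetime R -> R) (g : U -> spacetime R) p :
  {within slab T, continuous f} -> slab T p -> g @ F --> p ->
  (\forall u \near F, slab T (g u)) -> f \o g @ F --> f p.
Proof.
move=> /subspace_continuousP cf Kp gp Kg; apply: cvg_trans (cf p Kp).
move=> A /gp h.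
have {}h : \forall u \near F, slab T (g u) -> A (f (g u)) by exact: h.
suff: \forall u \near F, A (f (g u)) by [].
by apply: filterS2 h Kg => u hu /hu.
Qed.

Lemma clamped_continuous T (f : spacetime R -> R) : 0 < T ->
  {within slab T, continuous f} -> continuous (f \o clamp T).
Proof.
move=> T0 cf p.
apply: (cvg_within_slab T f (clamp T) (clamp T p) cf); first exact: clamp_slab.
  exact: clamp_continuous.
by near=> q; exact: clamp_slab.
Unshelve. all: by end_near. Qed.

(** An identity that holds on a half-open segment ending at [p] passes to [p] by
    continuity. It carries to closed faces, to the corners and to the time 0 the
    relations that are only assumed on open sets and for positive times. *)
Lemma eq_along_segment T (f g : spacetime R -> R) p c :
  {within slab T, continuous f} -> {within slab T, continuous g} -> slab T p ->
  (forall s, 0 < s <= 1 -> slab T (p + s *: (c - p)) /\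
     f (p + s *: (c - p)) = g (p + s *: (c - p))) ->
  f p = g p.
Proof.
move=> cf cg Kp h; pose r (s : R) := p + s *: (c - p).
have h' : \forall s \near 0^'+, slab T (r s) /\ f (r s) = g (r s).
  near=> s; apply: h; apply/andP; split=> //; near: s.
  exact: nbhs_right_le.
have rp : r @ 0^'+ --> p.
  apply: cvg_at_right_filter; rewrite -[X in _ --> X]addr0 -(scale0r (c - p)).
  by apply: cvgD; [exact: cvg_cst|apply: cvgZr_tmp; exact: cvg_id].
have fp : f \o r @ 0^'+ --> f p.
  by apply: (cvg_within_slab T f r p cf Kp rp); apply: filterS h' => s [].
have gp : g \o r @ 0^'+ --> g p.
  by apply: (cvg_within_slab T g r p cg Kp rp); apply: filterS h' => s [].
apply: (cvg_unique _ fp) => //; apply: cvg_trans gp; apply: near_eq_cvg.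
by apply: filterS h' => s [].
Unshelve. all: by end_near. Qed.

End geometry.

(** * Derivatives up to the boundary *)

Section calculus.
Context {R : realType}.
Variable T : R.
Implicit Types (p q : spacetime R) (d e : option 'I_3) (f g : spacetime R -> R).

Definition pd d f : spacetime R -> R := rel_derive (slab T) f (dir R d).

Lemma shift_slab p d (h : R) : slab T p ->
  0 <= stcoord p d + h <= extent T d -> slab T (p + h *: dir R d).
Proof.
move=> Kp ?; rewrite -[p in p + _](set_coord_id p d) set_coord_shift.
exact: set_coord_slab.
Qed.

(** Limits of relative quotients are unique: from any point of the slab one can
    move in the slab in at least one of the directions [dir R d], [- dir R d]. *)
Lemma slab_dir_proper p d : 0 < T -> slab T p ->
  ProperFilter (within [set h : R | slab T (p + h *: dir R d)] 0^').
Proof.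
move=> T0 Kp; have /slabP/(_ d)/andP[c0 cL] := Kp.
split; last exact: within_filter.
rewrite /within /= => /= H.
(* Move up, unless the point is on the upper end of its range; then move down,
   which is possible because the slab has positive width. *)
have [ltL|geL] := ltP (stcoord p d) (extent T d).
- suff : \forall h \near (0:R)^'+, False by move=> /filter_ex[].
  have H' : \forall h \near (0:R)^'+, slab T (p + h *: dir R d) -> False.
    rewrite near_withinE.
    have: \forall h \near (0 : R)^', slab T (p + h *: dir R d) -> False by exact: H.
    rewrite /dnbhs near_withinE.
    by apply: filterS => h + h0; apply; rewrite gt_eqF.
  near=> h; apply: (near H' h) => //.
  apply: shift_slab => //; apply/andP; split; first exact: addr_ge0.
  rewrite -lerBrDl; near: h; apply: nbhs_right_le; by rewrite subr_gt0.
- suff : \forall h \near (0:R)^'-, False by move=> /filter_ex[].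
  have H' : \forall h \near (0:R)^'-, slab T (p + h *: dir R d) -> False.
    rewrite near_withinE.
    have: \forall h \near (0 : R)^', slab T (p + h *: dir R d) -> False by exact: H.
    rewrite /dnbhs near_withinE.
    by apply: filterS => h + h0; apply; rewrite lt_eqF.
  near=> h; apply: (near H' h) => //.
  apply: shift_slab => //; apply/andP; split.
    rewrite -lerBlDl sub0r; near: h; apply: nbhs_left_ge.
    by rewrite oppr_lt0; apply: lt_le_trans geL; exact: extent_gt0.
  by rewrite -[leRHS]addr0 lerD.
Unshelve. all: by end_near. Qed.

Lemma rel_quotient_eq p d f g : slab T p -> {in slab T, f =1 g} ->
  rel_quotient (slab T) f (dir R d) p = rel_quotient (slab T) g (dir R d) p.
Proof.
move=> Kp fg.
have sub (f1 g1 : spacetime R -> R) : (forall q, slab T q -> f1 q = g1 q) ->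
    rel_quotient (slab T) f1 (dir R d) p `<=` rel_quotient (slab T) g1 (dir R d) p.
  move=> E A HA.
  have {}HA : \forall h \near within [set h : R | slab T (p + h *: dir R d)] 0^',
    A (h^-1 *: (f1 (p + h *: dir R d) - f1 p)) by exact: HA.
  suff : \forall h \near within [set h : R | slab T (p + h *: dir R d)] 0^',
    A (h^-1 *: (g1 (p + h *: dir R d) - g1 p)) by [].
  rewrite near_withinE in HA; rewrite near_withinE.
  by apply: filterS HA => h /[swap] Kh; rewrite !E//; exact.
by apply/seteqP; split; apply: sub => q Kq; rewrite fg// inE.
Qed.

(** Field equations are identities on the slab only; they can still be differentiated,
    up to the boundary, as relative derivatives ignore the values outside. *)
Lemma eq_pd p d f g : slab T p -> {in slab T, f =1 g} -> pd d f p = pd d g p.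
Proof. by move=> Kp fg; rewrite /pd /rel_derive (rel_quotient_eq p d f g). Qed.

Lemma pd_lin p d f g (a b : R) : 0 < T -> slab T p ->
  rel_derivable (slab T) f (dir R d) p -> rel_derivable (slab T) g (dir R d) p ->
  pd d (fun q => a * f q + b * g q) p = a * pd d f p + b * pd d g p.
Proof.
move=> T0 Kp df dg; have FF := slab_dir_proper p d T0 Kp.
apply: cvg_lim => //; rewrite /rel_quotient.
rewrite (_ : (fun h : R => _) = fun h : R =>
   a * (h^-1 *: (f (p + h *: dir R d) - f p)) +
   b * (h^-1 *: (g (p + h *: dir R d) - g p))).
  by apply: cvgD; apply: cvgM; [exact: cvg_cst|exact: df|exact: cvg_cst|exact: dg].
by apply/funext => h; rewrite /GRing.scale/=; ring.
Qed.

(** A function that vanishes on a line has zero derivative along it. On a face of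
    the cube this kills every tangential derivative, including the time derivative. *)
Lemma pd_eq0 p d f : 0 < T -> slab T p ->
  (forall q, slab T q -> (forall e, e != d -> stcoord q e = stcoord p e) -> f q = 0) ->
  pd d f p = 0.
Proof.
move=> T0 Kp f0; have FF := slab_dir_proper p d T0 Kp.
apply: cvg_lim => //; rewrite /rel_quotient.
apply: (@cvg_trans _ (cst (0 : R) @ within [set h : R | slab T (p + h *: dir R d)] 0^'));
  last exact: cvg_cst.
apply: near_eq_cvg.
rewrite near_withinE; apply: nearW => h /= Kh.
rewrite !f0 ?subrr ?scaler0// => e ed.
by rewrite stcoordD stcoordZ stcoord_dir (negbTE ed) mulr0 addr0.
Qed.

(** Inside its range of definition, a coordinate may be moved both ways, even when
    the other coordinates are on the boundary: relative derivatives are then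
    ordinary derivatives of functions of one variable. *)
Lemma set_coord_is_derive p d (s : R) f : slab T p -> 0 < s < extent T d ->
  rel_derivable (slab T) f (dir R d) (set_coord p d s) ->
  is_derive s 1 (fun r => f (set_coord p d r)) (pd d f (set_coord p d s)).
Proof.
move=> Kp /andP[s0 sL].
have E : rel_quotient (slab T) f (dir R d) (set_coord p d s) =
  (fun h : R => h^-1 *: (((fun r => f (set_coord p d r)) \o shift s) (h *: 1) -
    f (set_coord p d s))) @ (0 : R)^'.
  rewrite /rel_quotient.
  have -> : within [set h : R | slab T (set_coord p d s + h *: dir R d)] 0^' = 0^'.
    have Kh : \forall h \near (0:R)^', slab T (set_coord p d s + h *: dir R d).
      apply: nbhs_dnbhs; near=> h; rewrite set_coord_shift; apply: set_coord_slab => //.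
      apply/andP; split; apply: ltW.
        rewrite -ltrBlDl sub0r; near: h; apply: lt_nbhsr; by rewrite oppr_lt0.
      rewrite -ltrBrDl; near: h; apply: lt_nbhsl; by rewrite subr_gt0.
    apply/seteqP; split=> A HA; last by apply: filterS HA => h Ah _.
    by apply: filterS2 Kh HA => h Kh HA; exact: HA.
  suff -> : (fun h : R =>
      h^-1 *: (f (set_coord p d s + h *: dir R d) - f (set_coord p d s))) =
    (fun h : R => h^-1 *: (((fun r => f (set_coord p d r)) \o shift s) (h *: 1) -
    f (set_coord p d s))) by [].
  by apply/funext => h /=; rewrite set_coord_shift [s + _]addrC /GRing.scale/= mulr1.
rewrite /rel_derivable E => D; rewrite /pd /rel_derive E.
exact: (DeriveDef D erefl).
Unshelve. all: by end_near. Qed.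

(** What the fundamental theorem of calculus needs in order to integrate [df] along
    the direction [d], up to the boundary. Unlike [rel_Ck], it names the derivative
    and is closed under products by the one-variable rule. *)
Definition C1_along d f df := [/\ {within slab T, continuous f},
  {within slab T, continuous df} &
  forall p s, slab T p -> 0 < s < extent T d ->
    is_derive s 1 (fun r => f (set_coord p d r)) (df (set_coord p d s))].

Lemma rel_C1_along d f : 0 < T -> rel_Ck (slab T) 1 f -> C1_along d f (pd d f).
Proof.
move=> T0 [cf /(_ d)[df [cdf _]]]; split; [exact: cf|exact: cdf|move=> p s Kp sL].
apply: (set_coord_is_derive p d s f Kp sL); apply: df; apply: set_coord_slab => //.
by case/andP: sL => /ltW -> /ltW ->.
Qed.

Lemma set_coord_within_continuous d f p (a b : R) :
  {within slab T, continuous f} -> slab T p -> 0 <= a -> b <= extent T d ->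
  {within `[a, b], continuous (fun r => f (set_coord p d r))}.
Proof.
move=> cf Kp a0 bL; apply/subspace_continuousP => s /=.
rewrite in_itv/= => /andP[h1 h2].
have Ks : slab T (set_coord p d s).
  by apply: set_coord_slab => //; rewrite (le_trans a0)//= (le_trans h2).
have := @cvg_within_slab _ _ (within [set` `[a, b]] (nbhs s)) _ T f
  (set_coord p d) _ cf Ks.
apply; first by apply: cvg_within_filter; exact: set_coord_continuous.
rewrite near_withinE; apply: nearW => r /=; rewrite in_itv/= => /andP[r1 r2].
by apply: set_coord_slab => //; rewrite (le_trans a0)//= (le_trans r2).
Qed.

End calculus.

(** * The fundamental theorem along an axis, and the symmetry of second derivatives *)

Section symmetry_of_second_derivatives.
Context {R : realType}.
Variable T : R.
Hypothesis T0 : 0 < T.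
Implicit Types (p q : spacetime R) (d e : option 'I_3) (f g : spacetime R -> R).
Local Notation pd := (pd T).
Local Notation C1_along := (C1_along T).

Lemma FTC_coord d f df p (r : R) : C1_along d f df -> slab T p -> 0 < r <= extent T d ->
  (\int[@lebesgue_measure R]_(s in `[0%R, r]) (df (set_coord p d s))%:E =
   (f (set_coord p d r) - f (set_coord p d 0))%:E)%E.
Proof.
move=> [cf cdf D] Kp /andP[r0 rL].
have D' (s : R) : s \in `]0, r[ ->
    is_derive s 1 (fun s => f (set_coord p d s)) (df (set_coord p d s)).
  rewrite in_itv/= => /andP[s0 sr]; apply: D => //; rewrite s0/=.
  exact: lt_le_trans rL.
rewrite EFinB; apply: (@continuous_FTC2 R (fun s => df (set_coord p d s))
  (fun s => f (set_coord p d s))) => //.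
- exact: (set_coord_within_continuous T d df p 0 r cdf Kp).
- have /(continuous_within_itvP _ r0)[_ h1 h2] :=
    set_coord_within_continuous T d f p 0 r cf Kp (lexx _) rL.
  by split=> // s /D' [].
- by move=> s /D' Ds; rewrite derive1E; exact: derive_val.
Qed.

(** The two steps of the classical proof of the symmetry of second derivatives: the
    mean value theorem in the direction [d] for the increment of [f] in the
    direction [e], and then in the direction [e] for [pd d f]. *)
Lemma mixed_difference d e f p (h : R) : d != e -> rel_Ck (slab T) 2 f ->
  slab T p -> 0 < h -> stcoord p d + h <= extent T d -> stcoord p e + h <= extent T e ->
  exists2 x, stcoord p d <= x <= stcoord p d + h &
  exists2 y, stcoord p e <= y <= stcoord p e + h &
   (f (set_coord (set_coord p d (stcoord p d + h)) e (stcoord p e + h)) -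
    f (set_coord p d (stcoord p d + h))) -
   (f (set_coord p e (stcoord p e + h)) - f p) =
   h * h * pd e (pd d f) (set_coord (set_coord p d x) e y).
Proof.
move=> de C2f Kp h0 hd he.
have C1f : rel_Ck (slab T) 1 f.
  by move: C2f => [cf df]; split=> // a; have [? [? _]] := df a.
have C1df : rel_Ck (slab T) 1 (pd d f) by have [_ /(_ d)[]] := C2f.
set a := stcoord p d; set b := stcoord p e.
have /slabP Kp' := Kp.
have /andP[a0 aL] := Kp' d; have /andP[b0 bL] := Kp' e.
have [cf cdf D] := rel_C1_along T d f T0 C1f.
have [_ cddf D'] := rel_C1_along T e (pd d f) T0 C1df.
have Kb : slab T (set_coord p e (b + h)).
  by apply: set_coord_slab => //; rewrite he addr_ge0// ltW.
pose phi x := f (set_coord (set_coord p e (b + h)) d x) - f (set_coord p d x).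
have [x] : exists2 x, x \in `]a, a + h[ & phi (a + h) - phi a =
    (pd d f (set_coord (set_coord p e (b + h)) d x) - pd d f (set_coord p d x)) *
    (a + h - a).
  apply: (@MVT _ phi
    (fun x => pd d f (set_coord (set_coord p e (b + h)) d x) -
       pd d f (set_coord p d x))).
  - by rewrite ltrDl.
  - move=> x; rewrite in_itv/= => /andP[x1 x2].
    have xL : 0 < x < extent T d by rewrite (le_lt_trans a0 x1) (lt_le_trans x2 hd).
    by apply: is_deriveB; exact: D.
  - by move=> x; apply: cvgB; exact: set_coord_within_continuous.
rewrite in_itv/= => /andP[x1 x2] phiE.
exists x; first by rewrite !ltW.
have xL : 0 <= x <= extent T d.
  by rewrite (le_trans a0 (ltW x1)) (le_trans (ltW x2) hd).
have [y] : exists2 y, y \in `]b, b + h[ &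
  pd d f (set_coord (set_coord p d x) e (b + h)) -
  pd d f (set_coord (set_coord p d x) e b) =
  pd e (pd d f) (set_coord (set_coord p d x) e y) * (b + h - b).
  apply: (@MVT _ (fun y => pd d f (set_coord (set_coord p d x) e y))
    (fun y => pd e (pd d f) (set_coord (set_coord p d x) e y))).
  - by rewrite ltrDl.
  - move=> y; rewrite in_itv/= => /andP[y1 y2]; apply: D'.
      exact: set_coord_slab.
    by rewrite (le_lt_trans b0 y1) (lt_le_trans y2 he).
  - by apply: set_coord_within_continuous => //; exact: set_coord_slab.
rewrite in_itv/= => /andP[y1 y2] psiE.
exists y; first by rewrite !ltW.
have E : set_coord (set_coord p d x) e b = set_coord p d x.
  have -> : b = stcoord (set_coord p d x) e by rewrite stcoord_set eq_sym (negbTE de).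
  exact: set_coord_id.
rewrite E in psiE.
have a' : set_coord (set_coord p e (b + h)) d a = set_coord p e (b + h).
  have -> : a = stcoord (set_coord p e (b + h)) d by rewrite stcoord_set (negbTE de).
  exact: set_coord_id.
move: phiE; rewrite /phi a' set_coord_id -(set_coordC p d e x (b + h) de) psiE.
rewrite (set_coordC p e d) 1?eq_sym// => ->.
ring.
Qed.

Lemma lt_dist_split (u v w r : R) :
  `|u - w| < r -> `|v - w| < r -> `|u - v| < r + r.
Proof.
move=> uw vw; apply: (le_lt_trans (ler_distD w u v)).
by apply: ltrD => //; rewrite distrC.
Qed.

(** The mixed difference over a square of side [h] is symmetric in [d] and [e], so
    both mixed derivatives, at suitable points of the square, equal it divided by
    [h * h]. They agree at [p] by continuity, as [h] tends to 0. *)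
Lemma clairaut_open d e f p : rel_Ck (slab T) 2 f -> slab T p ->
  (forall a, stcoord p a < extent T a) -> pd e (pd d f) p = pd d (pd e f) p.
Proof.
move=> C2f Kp pL; have [->//|de] := eqVneq d e.
have cde : {within slab T, continuous (pd e (pd d f))}.
  by have [_ /(_ d)[_ [_ /(_ e)[_ []]]]] := C2f.
have ced : {within slab T, continuous (pd d (pd e f))}.
  by have [_ /(_ e)[_ [_ /(_ d)[_ []]]]] := C2f.
apply/eqP/negPn/negP => ne.
(* If the two derivatives differed at p, each would stay within half of their
   distance of its value at p on a small square, where they share a value. *)
pose eps := `|pd e (pd d f) p - pd d (pd e f) p| / 2.
have eps0 : 0 < eps by rewrite divr_gt0// normr_gt0 subr_eq0.
have /cvgrPdist_lt/(_ _ eps0) Ude := (subspace_continuousP _ _).1 cde p Kp.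
have /cvgrPdist_lt/(_ _ eps0) Ued := (subspace_continuousP _ _).1 ced p Kp.
rewrite near_withinE in Ude; rewrite near_withinE in Ued.
(* The plane through p spanned by the two directions; the formula is affine in
   ab, unlike the iterated change of coordinate, so its continuity is clear. *)
pose m (ab : R * R) : spacetime R :=
  p + (ab.1 - stcoord p d) *: dir R d + (ab.2 - stcoord p e) *: dir R e.
have mE x y : m (x, y) = set_coord (set_coord p d x) e y.
  by rewrite /m/= [in RHS]/set_coord stcoord_set eq_sym (negbTE de).
have mc : m @ (stcoord p d, stcoord p e) --> p.
  have -> : nbhs p = nbhs (p + 0 *: dir R d + 0 *: dir R e).
    by rewrite !scale0r !addr0.
  have c1 : (fun ab : R * R => ab.1 - stcoord p d) @
      (stcoord p d, stcoord p e) --> (0 : R).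
    rewrite -(subrr (stcoord p d)); apply: cvgB; [exact: cvg_fst|exact: cvg_cst].
  have c2 : (fun ab : R * R => ab.2 - stcoord p e) @
      (stcoord p d, stcoord p e) --> (0 : R).
    rewrite -(subrr (stcoord p e)); apply: cvgB; [exact: cvg_snd|exact: cvg_cst].
  apply: cvgD; last exact: cvgZr_tmp.
  by apply: cvgD; [exact: cvg_cst|exact: cvgZr_tmp].
have {mc} mc : \forall ab \near (stcoord p d, stcoord p e),
    (slab T (m ab) -> `|pd e (pd d f) p - pd e (pd d f) (m ab)| < eps) /\
    (slab T (m ab) -> `|pd d (pd e f) p - pd d (pd e f) (m ab)| < eps).
  exact: mc _ (filterI Ude Ued).
move/nbhs_ballP: mc => [r /= r0 hr].
pose h := Num.min (r / 2)
  (Num.min (extent T d - stcoord p d) (extent T e - stcoord p e)).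
have h0 : 0 < h by rewrite !lt_min divr_gt0// !subr_gt0 !pL.
have hd : stcoord p d + h <= extent T d by rewrite -lerBrDl !ge_min lexx !orbT.
have he : stcoord p e + h <= extent T e by rewrite -lerBrDl !ge_min lexx !orbT.
have hr2 : h < r.
  rewrite (@le_lt_trans _ _ (r / 2))// ?ge_min ?lexx// ltr_pdivrMr//.
  by rewrite mulr2n mulrDr mulr1 ltrDl.
have near_m x y :
    stcoord p d <= x <= stcoord p d + h -> stcoord p e <= y <= stcoord p e + h ->
    slab T (m (x, y)) /\ ball (stcoord p d, stcoord p e) r (x, y).
  move=> /andP[x1 x2] /andP[y1 y2]; have /slabP Kp' := Kp.
  have /andP[a0 _] := Kp' d; have /andP[b0 _] := Kp' e.
  split.
    rewrite mE; apply: set_coord_slab; first apply: set_coord_slab => //.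
      by rewrite (le_trans a0)// (le_trans x2).
    by rewrite (le_trans b0)// (le_trans y2).
  have B (a z : R) : a <= z -> z <= a + h -> ball a r z.
    move=> az zh; rewrite /ball/= distrC ger0_norm ?subr_ge0//.
    by rewrite (le_lt_trans _ hr2)// lerBlDl.
  by split; exact: B.
have [x Hx [y Hy E1]] := mixed_difference d e f p h de C2f Kp h0 hd he.
have ed : e != d by rewrite eq_sym.
have [y' Hy' [x' Hx' E2]] := mixed_difference e d f p h ed C2f Kp h0 he hd.
have E : pd e (pd d f) (m (x, y)) = pd d (pd e f) (m (x', y')).
  have hh : h * h != 0 by rewrite mulf_neq0// gt_eqF.
  rewrite !mE (set_coordC p d e x' y' de); apply: (mulfI hh).
  apply: (etrans (esym E1)); apply: (etrans _ E2).
  by rewrite (set_coordC p e d _ _ ed); ring.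
have [K1 B1] := near_m _ _ Hx Hy; have [K2 B2] := near_m _ _ Hx' Hy'.
have [h1 _] := hr _ B1; have [_ h2] := hr _ B2.
have {h1}l1 := h1 K1; have {h2}l2 := h2 K2; rewrite E in l1.
have := lt_dist_split _ _ _ _ l1 l2.
by rewrite /eps -splitr ltxx.
Qed.

Definition center : spacetime R := (T / 2, ((2^-1, 2^-1), 2^-1)).

Lemma stcoord_center d : stcoord center d = extent T d / 2.
Proof. by case: d => [i|//]; case: (ord3_cases i) => -> /=; rewrite mul1r. Qed.

Lemma stcoord_segment p c (s : R) d :
  stcoord (p + s *: (c - p)) d = stcoord p d + s * (stcoord c d - stcoord p d).
Proof. by rewrite stcoordD stcoordZ stcoordD stcoordN. Qed.

Lemma segment_slab p c (s : R) : slab T p -> slab T c -> 0 <= s <= 1 ->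
  slab T (p + s *: (c - p)).
Proof.
move=> /slabP Kp /slabP Kc /andP[s0 s1]; apply/slabP => d; rewrite stcoord_segment.
have /andP[? ?] := Kp d; have /andP[? ?] := Kc d.
by apply/andP; split; nra.
Qed.

(** Moving from [p] towards a point with an interior coordinate makes this coordinate
    interior at once, while the coordinates shared by [p] and [c] do not move. The
    center [c] may thus be that of the slab or that of a face. *)
Lemma segment_open p c (s : R) d :
  slab T p -> 0 < stcoord c d < extent T d -> 0 < s <= 1 ->
  0 < stcoord (p + s *: (c - p)) d < extent T d.
Proof.
move=> /slabP/(_ d)/andP[? ?] /andP[? ?] /andP[s0 s1]; rewrite stcoord_segment.
by apply/andP; split; nra.
Qed.

Lemma center_open d : 0 < stcoord center d < extent T d.
Proof.
by rewrite stcoord_center; have := extent_gt0 T d T0 => ?; apply/andP; split; lra.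
Qed.

Lemma center_slab : slab T center.
Proof. by apply/slabP => d; have /andP[/ltW -> /ltW ->] := center_open d. Qed.

Lemma eq_from_open f g p : {within slab T, continuous f} ->
  {within slab T, continuous g} -> slab T p ->
  (forall q, slab T q -> (forall d, 0 < stcoord q d < extent T d) -> f q = g q) ->
  f p = g p.
Proof.
move=> cf cg Kp fg; apply: (@eq_along_segment _ T f g p center) => // s /andP[s0 s1].
have Ks : slab T (p + s *: (center - p)).
  by apply: segment_slab => //; [exact: center_slab|rewrite (ltW s0)].
split=> //; apply: fg => // d; apply: segment_open => //; last by rewrite s0.
exact: center_open.
Qed.

Lemma clairaut d e f p : rel_Ck (slab T) 2 f -> slab T p ->
  pd e (pd d f) p = pd d (pd e f) p.
Proof.
move=> C2f Kp; apply: (eq_from_open (pd e (pd d f)) (pd d (pd e f)) p _ _ Kp).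
- by have [_ /(_ d)[_ [_ /(_ e)[_ []]]]] := C2f.
- by have [_ /(_ e)[_ [_ /(_ d)[_ []]]]] := C2f.
- by move=> q Kq oq; apply: clairaut_open => // a; have /andP[] := oq a.
Qed.

End symmetry_of_second_derivatives.

(** * Continuous functions on a product are measurable *)

(** A countable topological basis consisting of sets of the family [M], to be taken
    as the measurable sets. It is stable under products, which is why Borel sets of
    a product of second countable spaces are in the product sigma-algebra. *)
Definition has_countable_basis_in (X : topologicalType) (M : set_system X) :=
  exists (I : countType) (B : I -> set X), (forall i, M (B i)) /\
    forall x U, nbhs x U -> exists i, B i x /\ B i `<=` U.

Lemma has_countable_basis_in_prod (X Y : topologicalType) (M : set_system X)
    (N : set_system Y) (MN : set_system (X * Y)%type) :
  (forall A B, M A -> N B -> MN (A `*` B)) ->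
  has_countable_basis_in X M -> has_countable_basis_in Y N ->
  has_countable_basis_in (X * Y)%type MN.
Proof.
move=> prodMN [I [A [MA hA]]] [J [B [NB hB]]].
exists (I * J)%type, (fun ij => A ij.1 `*` B ij.2); split=> [ij|[x y] U].
  exact: prodMN.
move=> [[V W] /= [/hA[i [Aix AiV]] /hB[j [Bjy BjW]]] VWU].
exists (i, j); split=> // -[x' y'] /= [/AiV ? /BjW ?].
exact: VWU.
Qed.

Section measurability.
Context {R : realType}.

Lemma has_countable_basis_in_R :
  has_countable_basis_in R (@measurable _ (measurableTypeR R)).
Proof.
exists (rat * rat)%type, (fun q => `]ratr q.1, ratr q.2[%classic : set R).
split=> [q|x U /nbhs_ballP[e /= e0 xU]]; first exact: measurable_itv.
have /rat_in_itvoo[a ax] : x - e < x by rewrite ltrBlDr ltrDl.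
have /rat_in_itvoo[b bx] : x < x + e by rewrite ltrDl.
move: ax bx; rewrite !in_itv/= => /andP[a1 a2] /andP[b1 b2].
exists (a, b); split=> [|y]; rewrite /= in_itv/= ?a2//.
move=> /andP[y1 y2]; apply: xU; rewrite /ball/= distrC ltr_distl.
by rewrite (lt_trans a1 y1) (lt_trans y2 b2).
Qed.

Lemma has_countable_basis_in_spacetime :
  has_countable_basis_in (spacetime R) (@measurable _ (measurableTypeR R *
    (measurableTypeR R * measurableTypeR R * measurableTypeR R))%type).
Proof.
have hR := has_countable_basis_in_R.
have P d1 d2 (X : measurableType d1) (Y : measurableType d2) (A : set X) (B : set Y) :
  measurable A -> measurable B -> measurable (A `*` B) by exact: measurableX.
apply: has_countable_basis_in_prod; first exact: P.
  exact: hR.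
apply: has_countable_basis_in_prod; [exact: P| |exact: hR].
by apply: has_countable_basis_in_prod; [exact: P|exact: hR|exact: hR].
Qed.

(** An open preimage is the union of the basis sets that it contains, and there are
    only countably many of them. *)
Lemma continuous_measurable_spacetime (g : spacetime R -> R) : continuous g ->
  measurable_fun [set: (measurableTypeR R *
    (measurableTypeR R * measurableTypeR R * measurableTypeR R))%type] g.
Proof.
move=> cg; apply: (measurability _ (measurable_realfun.RGenOInfty.measurableE R)).
move=> _ [_ [x ->] <-]; rewrite setTI.
have [I [B [mB hB]]] := has_countable_basis_in_spacetime.
set U := g @^-1` _.
have -> : U = \bigcup_(i in [set i | B i `<=` U]) B i.
  apply/seteqP; split=> [p Up|p [i /= + Bip]]; last exact.
  have : nbhs p U by apply: cg; apply: open_nbhs_nbhs; split=> //; exact: interval_open.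
  by move=> /hB[i [Bip BiU]]; exists i.
rewrite bigcup_mkcond; apply: countable_bigcupT_measurable => [|i].
  exact: countableP.
by case: ifP.
Qed.

End measurability.

(** * Integration over the cube *)

Section product_sigma_finite.
Context d1 d2 (X : measurableType d1) (Y : measurableType d2) (R : realType).
Variables (m1 : {sigma_finite_measure set X -> \bar R})
  (m2 : {sigma_finite_measure set Y -> \bar R}).

(** The product measure under a name of its own, to which a sigma-finite structure is
    attached: Fubini on a threefold product needs one on the twofold product. *)
Definition sigma_finite_product := (m1 \x m2)%E.

HB.instance Definition _ := Measure.on sigma_finite_product.

Let sigma_finite_productT : sigma_finite setT sigma_finite_product.
Proof.
have /sigma_finiteP[F [TF ndF Foo]] := sigma_finiteT m1.
have /sigma_finiteP[G [TG ndG Goo]] := sigma_finiteT m2.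
exists (fun n => F n `*` G n).
  rewrite -setXTT TF TG; apply/seteqP; split=> [[x y]|[x y] [n _ [/= Fx Gy]]].
    move=> [/= [n _ Fnx] [k _ Gky]]; exists (maxn n k) => //; split.
      by move: x Fnx; exact/subsetPset/ndF/leq_maxl.
    by move: y Gky; exact/subsetPset/ndG/leq_maxr.
  by split; exists n.
move=> k; have [? ?] := Foo k; have [? ?] := Goo k.
split; first exact: measurableX.
by rewrite /sigma_finite_product product_measure1E// lte_mul_pinfty// ge0_fin_numE.
Qed.

HB.instance Definition _ := Measure_isSigmaFinite.Build _ _ _ sigma_finite_product
  sigma_finite_productT.

End product_sigma_finite.

Section fubini_rectangle.
Context d1 d2 (X : measurableType d1) (Y : measurableType d2) (R : realType).
Variables (m1 : {sigma_finite_measure set X -> \bar R})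
  (m2 : {sigma_finite_measure set Y -> \bar R}).
Variables (A : set X) (B : set Y) (f : X * Y -> \bar R).
Hypotheses (mA : measurable A) (mB : measurable B).
Hypothesis intf : (m1 \x m2)%E.-integrable (A `*` B) f.

Let intf' : (m1 \x m2)%E.-integrable setT (f \_ (A `*` B)).
Proof. exact: (integrable_mkcond _ (measurableX mA mB)).1 intf. Qed.

Lemma integral_setX12 : (\int[m1 \x m2]_(z in A `*` B) f z =
  \int[m1]_(x in A) \int[m2]_(y in B) f (x, y))%E.
Proof.
rewrite integral_mkcond -(integral12_prod_meas1 intf') [RHS]integral_mkcond.
apply: eq_integral => x _; rewrite /fubini_F patchE; case: ifPn => xA.
  rewrite [RHS]integral_mkcond; apply: eq_integral => y _.
  by rewrite !patchE in_setX/= xA.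
rewrite integral0_eq// => y _.
by rewrite patchE in_setX/= (negbTE xA).
Qed.

Lemma integral_setX21 : (\int[m1 \x m2]_(z in A `*` B) f z =
  \int[m2]_(y in B) \int[m1]_(x in A) f (x, y))%E.
Proof.
rewrite integral_mkcond -(integral21_prod_meas1 intf') [RHS]integral_mkcond.
apply: eq_integral => y _; rewrite /fubini_G patchE; case: ifPn => yB.
  rewrite [RHS]integral_mkcond; apply: eq_integral => x _.
  by rewrite !patchE in_setX/= yB andbT.
rewrite integral0_eq// => x _.
by rewrite patchE in_setX/= (negbTE yB) andbF.
Qed.

End fubini_rectangle.

Definition lebesgue1_sf {R : realType} :
  {sigma_finite_measure set (measurableTypeR R) -> \bar R} := lebesgue_measure.
Definition lebesgue2_sf {R : realType} : {sigma_finite_measure set _ -> \bar R} :=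
  sigma_finite_product _ _ _ _ R lebesgue1_sf lebesgue1_sf.
Definition lebesgue3_sf {R : realType} : {sigma_finite_measure set _ -> \bar R} :=
  sigma_finite_product _ _ _ _ R lebesgue2_sf lebesgue1_sf.

Section cube_integral.
Context {R : realType}.
Local Notation mu := (@lebesgue_measure R).
Local Notation mR := (measurableTypeR R).
Local Notation I01 := (`[0%R, 1%R]%classic : set R).

Lemma cubeE : @cube R = I01 `*` I01 `*` I01.
Proof.
apply/seteqP; split=> [[[x y] z] h|[[x y] z]].
  have := h 0; have := h 1; have := h 2; rewrite /Defs.coord/= => h2 h1 h0.
  by split; [split|]; rewrite /= in_itv.
move=> [[]]; rewrite /= !in_itv/= => h0 h1 h2 i.
by case: (ord3_cases i) => ->; rewrite /Defs.coord.
Qed.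

Definition set_scoord (i : 'I_3) (s : R) (X : Defs.space R) : Defs.space R :=
  if i == 0 then (s, X.1.2, X.2) else if i == 1 then (X.1.1, s, X.2) else (X.1, s).

Lemma set_coord_space (t : R) X i (s : R) :
  set_coord (t, X) (Some i) s = (t, set_scoord i s X).
Proof.
apply: stcoord_ext => d; rewrite stcoord_set; case: d => [j|//].
by case: (ord3_cases j) => ->; case: (ord3_cases i) => ->.
Qed.

Lemma lebesgue_segment0 (r : R) : 0 <= r -> (mu `[0%R, r] = r%:E)%E.
Proof.
move=> r0; rewrite lebesgue_measure_itv/= lte_fin sube0.
by case: ltgtP r0 => // <-.
Qed.

Lemma measurable_cube : measurable (@cube R : set (mR * mR * mR)).
Proof. by rewrite cubeE; do 2!apply: measurableX => //; exact: measurable_itv. Qed.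

Lemma lebesgue_cube : (lebesgue3 R (@cube R) = 1)%E.
Proof.
have mI : measurable (I01 : set mR) by exact: measurable_itv.
have mI2 : measurable (I01 `*` I01 : set (mR * mR)) by exact: measurableX.
rewrite cubeE product_measure1E//= product_measure1E//=.
by rewrite lebesgue_segment0//= !mule1.
Qed.

Lemma bounded_integrable d (Y : measurableType d) (m : {measure set Y -> \bar R})
    (A : set Y) (g : Y -> R) (M : R) :
  measurable A -> (m A < +oo)%E -> measurable_fun setT g -> (forall y, `|g y| <= M) ->
  m.-integrable A (EFin \o g).
Proof.
move=> mA Aoo mg gM; apply: measurable_bounded_integrable => //.
  exact: measurable_funS mg.
exists M; split; first exact: num_real.
by move=> N MN y _ /=; rewrite (le_trans (gM y))// ltW.
Qed.

(** Fubini with the [i]-th coordinate integrated first. *)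
Lemma integral_cube_eq0 (i : 'I_3) (g : mR * mR * mR -> R) (M : R) :
  measurable_fun setT g -> (forall X, `|g X| <= M) ->
  (forall X, @cube R X -> (\int[mu]_(s in I01) (g (set_scoord i s X))%:E = 0)%E) ->
  (\int[lebesgue3 R]_(X in @cube R) (g X)%:E = 0)%E.
Proof.
move=> mg gM g0.
have mI : measurable (I01 : set mR) by exact: measurable_itv.
have mI2 : measurable (I01 `*` I01 : set (mR * mR)) by exact: measurableX.
have ig : (lebesgue3 R).-integrable (I01 `*` I01 `*` I01) (EFin \o g).
  apply: (bounded_integrable _ _ _ _ _ M) => //.
    exact: measurableX.
  rewrite -cubeE.
  have c1 : (lebesgue3 R (@cube R) < +oo)%E by rewrite lebesgue_cube ltry.
  exact: c1.
have c2 : ((mu \x mu)%E (I01 `*` I01) < +oo)%E.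
  by rewrite product_measure1E//= !lebesgue_segment0// mule1 ltry.
have ig2 z : (mu \x mu)%E.-integrable (I01 `*` I01) (EFin \o (fun u => g (u, z))).
  apply: (bounded_integrable _ _ _ _ _ M) => //.
  exact: measurable_fun_pair1.
have incube x y z : I01 x -> I01 y -> I01 z -> @cube R (x, y, z).
  by move=> ? ? ?; rewrite cubeE.
have I0 : I01 0 by rewrite /= in_itv/= lexx ler01.
have [/eqP i2|i2] := boolP (i == 2).
  rewrite cubeE.
  apply: (etrans (integral_setX12 _ _ _ _ R lebesgue2_sf lebesgue1_sf _ _
    (EFin \o g) mI2 mI ig)).
  apply: integral0_eq => -[x y] [Ix Iy].
  by move: (g0 (x, y, 0) (incube _ _ _ Ix Iy I0)); rewrite i2.
rewrite cubeE.
apply: (etrans (integral_setX21 _ _ _ _ R lebesgue2_sf lebesgue1_sf _ _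
    (EFin \o g) mI2 mI ig)).
apply: integral0_eq => z Iz.
have [/eqP i0|i0] := boolP (i == 0).
  apply: (etrans (integral_setX21 _ _ _ _ R lebesgue1_sf lebesgue1_sf _ _
    (EFin \o (fun u => g (u, z))) mI mI (ig2 z))).
  apply: integral0_eq => y Iy.
  by move: (g0 (0, y, z) (incube _ _ _ I0 Iy Iz)); rewrite i0.
have i1 : i = 1 by case: (ord3_cases i) i0 i2 => ->.
apply: (etrans (integral_setX12 _ _ _ _ R lebesgue1_sf lebesgue1_sf _ _
  (EFin \o (fun u => g (u, z))) mI mI (ig2 z))).
apply: integral0_eq => x Ix.
by move: (g0 (x, 0, z) (incube _ _ _ Ix I0 Iz)); rewrite i1.
Qed.

Lemma clamp_bounded (T : R) (f : spacetime R -> R) : 0 < T ->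
  {within slab T, continuous f} -> exists M, forall p, `|f (clamp T p)| <= M.
Proof.
move=> T0 cf.
have cK : compact (slab T).
  rewrite /slab cubeE.
  have cI (r : R) : compact [set t : R | 0 <= t <= r].
    rewrite (_ : [set t : R | 0 <= t <= r] = `[0, r]%classic).
      exact: segment_compact.
    by apply/seteqP; split=> t; rewrite /= in_itv.
  apply: compact_setX; first exact: cI.
  by apply: compact_setX; first apply: compact_setX; exact: segment_compact.
have /compact_bounded[M [_ hM]] := continuous_compact cf cK.
exists (`|M| + 1) => p; apply: hM; first by rewrite ltr_pwDr// ler_norm.
by exists (clamp T p) => //; exact: clamp_slab.
Qed.

End cube_integral.

(** * Integrated conservation laws *)

Section conservation.
Context {R : realType}.
Variable T : R.
Hypothesis T0 : 0 < T.
Local Notation mR := (measurableTypeR R).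
Local Notation mspace := (mR * mR * mR)%type.
Local Notation mu := (@lebesgue_measure R).
Local Notation pd := (pd T).
Local Notation C1_along := (C1_along T).

Lemma cube_slab (t : R) X : 0 <= t <= T -> @cube R X -> slab T (t, X).
Proof. by move=> tT cX; split. Qed.

Lemma measurable_clamped (f : spacetime R -> R) :
  {within slab T, continuous f} ->
  measurable_fun [set: (mR * mspace)%type] (f \o clamp T).
Proof.
by move=> cf; apply: continuous_measurable_spacetime; exact: clamped_continuous.
Qed.

Lemma measurable_clamped_at (f : spacetime R -> R) (t : R) :
  {within slab T, continuous f} ->
  measurable_fun [set: mspace] (fun X => f (clamp T (t, X))).
Proof.
move=> cf; exact: (measurable_fun_pair2 t (measurable_clamped f cf)).
Qed.

Lemma integrable_clamped_at (f : spacetime R -> R) (t : R) :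
  {within slab T, continuous f} ->
  lebesgue3_sf.-integrable (@cube R) (EFin \o (fun X => f (clamp T (t, X)))).
Proof.
move=> cf; have [M fM] := clamp_bounded T f T0 cf.
apply: (bounded_integrable _ _ _ _ _ M) => //.
- exact: measurable_cube.
- have c1 : (lebesgue3 R (@cube R) < +oo)%E by rewrite lebesgue_cube ltry.
  exact: c1.
- exact: measurable_clamped_at.
Qed.

Lemma integrable_clamped (f : spacetime R -> R) (t : R) : 0 <= t ->
  {within slab T, continuous f} ->
  (lebesgue1_sf \x lebesgue3_sf)%E.-integrable (`[0, t] `*` @cube R)
    (EFin \o (f \o clamp T)).
Proof.
move=> t0 cf; have [M fM] := clamp_bounded T f T0 cf.
have mI : measurable (`[0, t]%classic : set mR) by exact: measurable_itv.
have mC := @measurable_cube R.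
apply: (bounded_integrable _ _ _ _ _ M) => //.
- exact: measurableX.
- have c1 : ((lebesgue1_sf \x lebesgue3_sf)%E (`[0%R, t]%classic `*` @cube R) < +oo)%E.
    rewrite product_measure1E//.
    have -> : lebesgue3_sf (@cube R) = 1%E by exact: lebesgue_cube.
    by rewrite mule1 /lebesgue1_sf/= lebesgue_segment0// ltry.
  exact: c1.
- exact: measurable_clamped.
Qed.

(** One term of the divergence theorem on the cube: by the fundamental theorem of
    calculus along the [i]-th axis, the integral of the derivative of [S] is that of
    the difference of the values of [S] on two opposite faces, which are zero. *)
Lemma flux_integral0 (i : 'I_3) (S dS : spacetime R -> R) (t : R) :
  C1_along (Some i) S dS ->
  (forall p, slab T p -> stcoord p (Some i) = 0 \/ stcoord p (Some i) = 1 -> S p = 0) ->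
  0 <= t <= T ->
  (\int[lebesgue3_sf]_(X in @cube R) (dS (clamp T (t, X)))%:E = 0)%E.
Proof.
move=> SdS S0 tT; have [_ cdS _] := SdS.
have [M dSM] := clamp_bounded T dS T0 cdS.
apply: (integral_cube_eq0 i (fun X => dS (clamp T (t, X))) M) => //.
  exact: measurable_clamped_at.
move=> X cX; have Kp := cube_slab t X tT cX.
have K01 s : 0 <= s <= 1 -> slab T (set_coord (t, X) (Some i) s).
  by move=> h; exact: (set_coord_slab T (t, X) (Some i) s Kp h).
transitivity (\int[mu]_(s in `[0%R, 1%R]) (dS (set_coord (t, X) (Some i) s))%:E)%E.
  apply: eq_integral => s; rewrite inE/= in_itv/= => s01.
  by rewrite -set_coord_space clamp_id//; exact: K01.
have i01 : 0 < (1 : R) <= extent T (Some i) by rewrite ltr01 /=.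
apply: (etrans (FTC_coord T (Some i) S dS (t, X) 1 SdS Kp i01)).
rewrite !S0 ?subrr//.
- by apply: K01; rewrite lexx ler01.
- by rewrite stcoord_set eqxx; left.
- by apply: K01; rewrite ler01 lexx.
- by rewrite stcoord_set eqxx; right.
Qed.

(** A density [e] whose time derivative is a divergence with no flux through the
    faces has a constant integral. The statement is proved in integrated form, so
    that no derivative is taken under the integral sign: the increment of [e] is the
    time integral of [de], and by Fubini the space integral of [de] comes first. *)
Lemma integral_conserved (e de : spacetime R -> R) (S dS : 'I_3 -> spacetime R -> R)
    (t : R) :
  C1_along None e de -> (forall i, C1_along (Some i) (S i) (dS i)) ->
  (forall p, slab T p -> de p = \sum_i dS i p) ->
  (forall i p, slab T p ->
    stcoord p (Some i) = 0 \/ stcoord p (Some i) = 1 -> S i p = 0) ->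
  0 <= t <= T ->
  (\int[lebesgue3_sf]_(X in @cube R) (e (t, X))%:E =
   \int[lebesgue3_sf]_(X in @cube R) (e (clamp T (0%R, X)))%:E)%E.
Proof.
move=> ede SdS deE S0 /andP[t0 tT].
have tT' : 0 <= t <= T by rewrite t0.
have [ce cde _] := ede.
have ie r := integrable_clamped_at e r ce.
transitivity (\int[lebesgue3_sf]_(X in @cube R) (e (clamp T (t, X)))%:E)%E.
  apply: eq_integral => X; rewrite inE => cX; congr EFin.
  by rewrite clamp_id//; exact: cube_slab.
move: t0; rewrite le_eqVlt => /predU1P[<-//|t0].
have mC := @measurable_cube R.
have mI : measurable (`[0, t]%classic : set mR) by exact: measurable_itv.
have ide := integrable_clamped de t (ltW t0) cde.
have H : (\int[lebesgue3_sf]_(X in @cube R) \int[lebesgue1_sf]_(s in `[0%R, t])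
    (de (clamp T (s, X)))%:E = 0)%E.
  apply: (etrans (esym (integral_setX21 _ _ _ _ R lebesgue1_sf lebesgue3_sf _ _
    (EFin \o (de \o clamp T)) mI mC ide))).
  apply: (etrans (integral_setX12 _ _ _ _ R lebesgue1_sf lebesgue3_sf _ _
    (EFin \o (de \o clamp T)) mI mC ide)).
  apply: integral0_eq => s; rewrite /= in_itv/= => /andP[s0 st].
  have sT : 0 <= s <= T by rewrite s0 (le_trans st).
  transitivity (\int[lebesgue3_sf]_(X in @cube R)
      (\sum_(i < 3) (dS i (clamp T (s, X)))%:E))%E.
    apply: eq_integral => X; rewrite inE => cX.
    by rewrite deE ?sumEFin//; exact: clamp_slab.
  rewrite (@integral_sum _ _ _ lebesgue3_sf _ mC _
    (fun i X => (dS i (clamp T (s, X)))%:E)).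
    by apply: big1 => i _; exact: (flux_integral0 i (S i) (dS i) s (SdS i) (S0 i) sT).
  by move=> i; have [_ cdS _] := SdS i; exact: (integrable_clamped_at (dS i) s cdS).
have H2 : (\int[lebesgue3_sf]_(X in @cube R)
    ((e (clamp T (t, X)))%:E - (e (clamp T (0%R, X)))%:E) = 0)%E.
  rewrite -[RHS]H; apply: eq_integral => X; rewrite inE => cX.
  have K0 : slab T (0, X) by apply: cube_slab => //; rewrite lexx ltW.
  have lE s : set_coord (0, X) None s = (s, X).
    apply: stcoord_ext => d; rewrite stcoord_set; case: d => [i|]//=.
  have tL : 0 < t <= extent T None by rewrite t0.
  have F := FTC_coord T None e de (0, X) t ede K0 tL.
  have Kt : slab T (t, X) by exact: cube_slab.
  rewrite (clamp_id _ _ K0) (clamp_id _ _ Kt).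
  rewrite -EFinB; have := F; rewrite !lE => <-.
  apply: eq_integral => s; rewrite inE/= in_itv/= => /andP[s0 st].
  rewrite lE clamp_id//; apply: cube_slab => //.
  by rewrite s0 (le_trans st).
move: (etrans (esym (integralB_EFin mC (ie t) (ie 0))) H2) => /eqP.
have ft := integrable_fin_num mC (ie t); have f0 := integrable_fin_num mC (ie 0).
rewrite sube_eq ?add0e; [by move=> /eqP|exact: ft|exact: fin_num_adde_defl].
Qed.

End conservation.

(** * Derivatives of products and of fields *)

Section C1_along_algebra.
Context {R : realType}.
Variable T : R.
Local Notation C1_along := (C1_along T).

Lemma C1_along_lin d (f df g dg : spacetime R -> R) (a b : R) :
  C1_along d f df -> C1_along d g dg ->
  C1_along d (fun p => a * f p + b * g p) (fun p => a * df p + b * dg p).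
Proof.
move=> [cf cdf Df] [cg cdg Dg]; split.
- by move=> p; apply: cvgD; apply: cvgM;
    [exact: cvg_cst|exact: cf|exact: cvg_cst|exact: cg].
- by move=> p; apply: cvgD; apply: cvgM;
    [exact: cvg_cst|exact: cdf|exact: cvg_cst|exact: cdg].
- move=> p s Kp sL; have Dfs := Df p s Kp sL; have Dgs := Dg p s Kp sL.
  by apply: is_derive_eq; rewrite /GRing.scale/=; ring.
Qed.

Lemma C1_alongM d (f df g dg : spacetime R -> R) :
  C1_along d f df -> C1_along d g dg ->
  C1_along d (fun p => f p * g p) (fun p => df p * g p + f p * dg p).
Proof.
move=> [cf cdf Df] [cg cdg Dg]; split.
- by move=> p; apply: cvgM; [exact: cf|exact: cg].
- by move=> p; apply: cvgD; apply: cvgM;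
    [exact: cdf|exact: cg|exact: cf|exact: cdg].
- move=> p s Kp sL; have Dfs := Df p s Kp sL; have Dgs := Dg p s Kp sL.
  by apply: is_derive_eq; rewrite /GRing.scale/=; ring.
Qed.

Lemma C1_along_eq d (f df f' df' : spacetime R -> R) :
  f =1 f' -> df =1 df' -> C1_along d f df -> C1_along d f' df'.
Proof. by move=> /funext -> /funext ->. Qed.

Lemma C1_along_sum d (f df : 'I_3 -> spacetime R -> R) :
  (forall i, C1_along d (f i) (df i)) ->
  C1_along d (fun p => \sum_i f i p) (fun p => \sum_i df i p).
Proof.
move=> fdf; have := C1_along_lin _ _ _ _ _ 1 1
  (C1_along_lin _ _ _ _ _ 1 1 (fdf 0) (fdf 1)) (fdf 2).
by apply: C1_along_eq => p; rewrite sum_ord3 !mul1r.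
Qed.

End C1_along_algebra.

Section fields.
Context {R : realType}.
Variables (T : R) (f : spacetime R -> R).
Hypothesis T0 : 0 < T.
Hypothesis C2f : rel_Ck (slab T) 2 f.

Lemma C2_continuous : {within slab T, continuous f}.
Proof. by case: C2f. Qed.

Lemma C2_pd_continuous d : {within slab T, continuous (pd T d f)}.
Proof. by case: C2f => [_ /(_ d)[_ []]]. Qed.

Lemma C2_pd_derivable d e p : slab T p ->
  rel_derivable (slab T) (pd T d f) (dir R e) p.
Proof. by case: C2f => [_ /(_ d)[_ [_ /(_ e)[h _]]]]; exact: h. Qed.

Lemma C2_C1_along_pd d e : C1_along T e (pd T d f) (pd T e (pd T d f)).
Proof.
by apply: rel_C1_along => //; case: C2f => [_ /(_ d)[]].
Qed.

End fields.

Section cube_interior.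
Context {R : realType}.

Lemma cube_interior (X : Defs.space R) : (forall i, 0 < Defs.coord X i < 1) ->
  (@cube R)° X.
Proof.
move=> X01; pose j (Y : Defs.space R) : spacetime R := (0, Y).
have cj : j @ X --> j X.
  have c0 : cst (0 : R) @ X --> (0 : R) by exact: cvg_cst.
  have cX : (fun Y : Defs.space R => Y) @ X --> X by exact: cvg_id.
  exact: cvg_pair c0 cX.
suff : \forall Y \near X, forall i : 'I_3, 0 <= Defs.coord Y i <= 1 by [].
apply: (@filter_forall _ 'I_3 (fun i Y => 0 <= Defs.coord Y i <= 1 : Prop)
  (nbhs X)) => i.
have /andP[X0 X1] := X01 i.
have c : (fun Y => Defs.coord Y i) @ X --> Defs.coord X i.
  exact: cvg_comp cj (stcoord_continuous (Some i) (j X)).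
near=> Y; apply/andP; split; apply: ltW; near: Y.
- exact: (cvgr_gt _ c).
- exact: (cvgr_lt _ c).
Unshelve. all: by end_near. Qed.

End cube_interior.

(** * The energy balance of the derivatives of a Maxwell field *)

(** The identity div (A x B) = B . curl A - A . curl B, up to the factor -2, when
    [dA i j] stands for the derivative of the [j]-th component of A along the [i]-th
    axis, and likewise for [dB]. *)
Lemma div_cross (R : comRingType) (A B : 'I_3 -> R) (dA dB : 'I_3 -> 'I_3 -> R) :
  \sum_i (2 * (dB (i + 1) (i + 2) - dB (i + 2) (i + 1)) * A i +
          2 * (dA (i + 2) (i + 1) - dA (i + 1) (i + 2)) * B i) =
  \sum_i 2 * ((dA i (i + 2) * B (i + 1) + A (i + 2) * dB i (i + 1)) -
              (dA i (i + 1) * B (i + 2) + A (i + 1) * dB i (i + 2))).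
Proof.
have e01 : 0 + 1 = 1 :> 'I_3 by exact: add0r.
have e02 : 0 + 2 = 2 :> 'I_3 by exact: add0r.
have e11 : 1 + 1 = 2 :> 'I_3 by exact/val_inj.
have e12 : 1 + 2 = 0 :> 'I_3 by exact/val_inj.
have e21 : 2 + 1 = 0 :> 'I_3 by exact/val_inj.
have e22 : 2 + 2 = 1 :> 'I_3 by exact/val_inj.
rewrite !sum_ord3 !(e01, e02, e11, e12, e21, e22).
ring.
Qed.

Section maxwell_system.
Context {R : realType}.
Variables (T eps mu : R) (E H : spacetime R -> 'rV[R]_3).
Hypothesis T0 : 0 < T.
Hypotheses (C2E : C2_field T E) (C2H : C2_field T H).
Hypothesis maxwellEH : maxwell T eps mu E H.
Hypothesis pecEH : PEC T E H.
Local Notation pd := (pd T).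

Let E_ i q := E q 0 i.
Let H_ i q := H q 0 i.

(** The equations in components, extended by continuity to the time 0 and to the
    boundary of the cube, where they are needed to control normal derivatives. *)
Lemma maxwell_slab i p : slab T p ->
  eps * pd None (E_ i) p =
    pd (Some (i + 1)) (H_ (i + 2)) p - pd (Some (i + 2)) (H_ (i + 1)) p /\
  mu * pd None (H_ i) p =
    pd (Some (i + 2)) (E_ (i + 1)) p - pd (Some (i + 1)) (E_ (i + 2)) p.
Proof.
move=> Kp; have open q : slab T q -> (forall d, 0 < stcoord q d < extent T d) ->
    eps * pd None (E_ i) q =
      pd (Some (i + 1)) (H_ (i + 2)) q - pd (Some (i + 2)) (H_ (i + 1)) q /\
    mu * pd None (H_ i) q =
      pd (Some (i + 2)) (E_ (i + 1)) q - pd (Some (i + 1)) (E_ (i + 2)) q.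
  case: q => t X Kq oq; have /andP[t0 tT] := oq None.
  have t0T : 0 < t <= T by apply/andP; split; [exact: t0|exact: ltW].
  have Xint : (@cube R)° X by apply: cube_interior => j; exact: (oq (Some j)).
  have [h1 h2] := maxwellEH t X t0T Xint.
  have {}h1 := congr1 (fun u : 'rV[R]_3 => u 0 i) h1.
  have {}h2 := congr1 (fun u : 'rV[R]_3 => u 0 i) h2.
  rewrite /= !mxE in h1; rewrite /= !mxE opprB in h2.
  by split; [exact: h1|exact: h2].
have cE d j : {within slab T, continuous (pd d (E_ j))}.
  exact: C2_pd_continuous (C2E j) d.
have cH d j : {within slab T, continuous (pd d (H_ j))}.
  exact: C2_pd_continuous (C2H j) d.
split.
- apply: (eq_from_open T T0 (fun q => eps * pd None (E_ i) q)
    (fun q => pd (Some (i + 1)) (H_ (i + 2)) q - pd (Some (i + 2)) (H_ (i + 1)) q)) => //.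
  + by move=> q; apply: cvgM; [exact: cvg_cst|exact: cE].
  + by move=> q; apply: cvgB; exact: cH.
  + by move=> q Kq oq; have [] := open q Kq oq.
- apply: (eq_from_open T T0 (fun q => mu * pd None (H_ i) q)
    (fun q => pd (Some (i + 2)) (E_ (i + 1)) q - pd (Some (i + 1)) (E_ (i + 2)) q)) => //.
  + by move=> q; apply: cvgM; [exact: cvg_cst|exact: cH].
  + by move=> q; apply: cvgB; exact: cE.
  + by move=> q Kq oq; have [] := open q Kq oq.
Qed.

Lemma PEC_open_face i (b : bool) t X : 0 < t <= T -> face i b X ->
  [/\ E_ (i + 1) (t, X) = 0, E_ (i + 2) (t, X) = 0 & H_ i (t, X) = 0].
Proof.
move=> tT fX; have [crossE dotH] := pecEH t X i b tT fX.
have [a11 a12 a21 a22] := ord3_addE i.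
have [n1 n2] := ord3_add_neq i.
pose sg : R := if b then 1 else -1.
have sg0 : sg != 0 by rewrite /sg; case: (b); rewrite ?oppr_eq0 oner_eq0.
have nE j : normal i b 0 j = sg * (j == i)%:R by rewrite /normal !mxE eqxx.
have c1 := congr1 (fun u : 'rV[R]_3 => u 0 (i + 1)) crossE.
have c2 := congr1 (fun u : 'rV[R]_3 => u 0 (i + 2)) crossE.
rewrite /= !mxE -/(normal i b) in c1 c2.
move: c1 c2; rewrite a11 a12 a21 a22 !eqxx ?n1 ?n2/=.
rewrite -/sg !mulr0 !mul0r !mulr1 subr0 sub0r => /eqP c1 /eqP c2.
split.
- by move: c2; rewrite mulf_eq0 (negbTE sg0) => /eqP.
- by move: c1; rewrite oppr_eq0 mulf_eq0 (negbTE sg0) => /eqP.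
- move: dotH; rewrite /dot (bigD1 i)//= big1 ?addr0.
    rewrite nE eqxx mulr1 => /eqP; rewrite mulf_eq0 (negbTE sg0) => /eqP; exact.
  by move=> j ji; rewrite nE (negbTE ji) mulr0 mul0r.
Qed.

(** The boundary conditions on the closed faces and at time 0: go from [p] towards the
    center of the face, at mid-time. *)
Lemma PEC_slab i (b : bool) p : slab T p -> stcoord p (Some i) = b%:R ->
  [/\ E_ (i + 1) p = 0, E_ (i + 2) p = 0 & H_ i p = 0].
Proof.
move=> Kp pb; pose c := set_coord (center T) (Some i) b%:R.
have Kc : slab T c.
  apply: set_coord_slab; first exact: center_slab.
  by case: (b); rewrite /= ?lexx ler01.
have seg s : 0 < s <= 1 -> slab T (p + s *: (c - p)) /\
    [/\ E_ (i + 1) (p + s *: (c - p)) = 0, E_ (i + 2) (p + s *: (c - p)) = 0 &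
       H_ i (p + s *: (c - p)) = 0].
  move=> s01; have /andP[s0 s1] := s01.
  split; first by apply: segment_slab => //; rewrite (ltW s0).
  have o d : d != Some i -> 0 < stcoord (p + s *: (c - p)) d < extent T d.
    move=> di; apply: segment_open => //; rewrite stcoord_set (negbTE di).
    exact: center_open.
  have ob : stcoord (p + s *: (c - p)) (Some i) = b%:R.
    by rewrite stcoord_segment stcoord_set eqxx pb subrr mulr0 addr0.
  case: (p + s *: (c - p)) o ob => t X o ob.
  apply: (PEC_open_face i b).
    have /andP[t0 tT] := o None isT.
    by apply/andP; split; [exact: t0|exact: ltW].
  by split; [exact: ob|move=> j ji; apply: (o (Some j))].
have along (f : spacetime R -> R) : {within slab T, continuous f} ->
    (forall s, 0 < s <= 1 -> f (p + s *: (c - p)) = 0) -> f p = 0.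
  move=> cf f0; apply: (eq_along_segment T f (cst 0) p c cf) => //.
    by move=> q; exact: cvg_cst.
  by move=> s s01; have [Ks _] := seg s s01; split=> //; exact: f0.
by split; apply: along => [|s s01]; [exact: C2_continuous (C2E _)|have [_ []] := seg s s01|
  exact: C2_continuous (C2E _)|have [_ []] := seg s s01|
  exact: C2_continuous (C2H _)|have [_ []] := seg s s01].
Qed.

Lemma PEC_tangential_pd i (b : bool) d p : slab T p -> stcoord p (Some i) = b%:R ->
  d != Some i ->
  [/\ pd d (E_ (i + 1)) p = 0, pd d (E_ (i + 2)) p = 0 & pd d (H_ i) p = 0].
Proof.
move=> Kp pb di.
by split; apply: pd_eq0 => // q Kq qp;
  have [] := PEC_slab i b q Kq; rewrite // qp// eq_sym.
Qed.

(** The equations control normal derivatives. On the face, the tangential components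
    of curl H are [eps] times the time derivative of tangential components of E, hence
    zero. Each of them is a difference of a tangential derivative of the normal
    component of H, also zero, and of the normal derivative of a tangential component
    of H. *)
Lemma PEC_normal_pd i (b : bool) p : slab T p -> stcoord p (Some i) = b%:R ->
  pd (Some i) (H_ (i + 1)) p = 0 /\ pd (Some i) (H_ (i + 2)) p = 0.
Proof.
move=> Kp pb; have [a11 a12 a21 a22] := ord3_addE i; have [n1 n2] := ord3_add_neq i.
have [tE1 tE2 _] := PEC_tangential_pd i b None p Kp pb isT.
have [_ _ tH1] := PEC_tangential_pd i b (Some (i + 1)) p Kp pb (negbT n1).
have [_ _ tH2] := PEC_tangential_pd i b (Some (i + 2)) p Kp pb (negbT n2).
have [+ _] := maxwell_slab (i + 1) p Kp; have [+ _] := maxwell_slab (i + 2) p Kp.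
rewrite a11 a12 a21 a22 tE1 tE2 tH1 tH2 mulr0 subr0 sub0r => h1 h2.
by split; [exact: esym|apply/eqP; rewrite -oppr_eq0 -h2].
Qed.

Section poynting.
Variable w : 'I_3.
Let Ew i := pd (Some w) (E_ i).
Let Hw i := pd (Some w) (H_ i).

(** The equations have constant coefficients, so the derivatives along the [w]-th axis
    satisfy them too: this is the symmetry of second derivatives applied to each term. *)
Lemma pd_maxwell i p : slab T p ->
  eps * pd None (Ew i) p =
    pd (Some (i + 1)) (Hw (i + 2)) p - pd (Some (i + 2)) (Hw (i + 1)) p /\
  mu * pd None (Hw i) p =
    pd (Some (i + 2)) (Ew (i + 1)) p - pd (Some (i + 1)) (Ew (i + 2)) p.
Proof.
have aux (c : R) (f g h : spacetime R -> R) (d1 d2 : option 'I_3) :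
    rel_Ck (slab T) 2 f -> rel_Ck (slab T) 2 g -> rel_Ck (slab T) 2 h ->
    (forall q, slab T q -> c * pd None f q = pd d1 g q - pd d2 h q) ->
    slab T p ->
    c * pd None (pd (Some w) f) p = pd d1 (pd (Some w) g) p - pd d2 (pd (Some w) h) p.
  move=> Cf Cg Ch fgh Kp.
  rewrite (clairaut T T0 (Some w) None f p Cf Kp).
  rewrite (clairaut T T0 (Some w) d1 g p Cg Kp) (clairaut T T0 (Some w) d2 h p Ch Kp).
  have lin1 := pd_lin T p (Some w) (pd None f) (pd None f) c 0 T0 Kp
    (C2_pd_derivable T f Cf None (Some w) p Kp)
    (C2_pd_derivable T f Cf None (Some w) p Kp).
  have lin2 := pd_lin T p (Some w) (pd d1 g) (pd d2 h) 1 (-1) T0 Kp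
    (C2_pd_derivable T g Cg d1 (Some w) p Kp)
    (C2_pd_derivable T h Ch d2 (Some w) p Kp).
  rewrite mul0r addr0 in lin1; rewrite mul1r mulN1r in lin2.
  rewrite -lin1 -lin2; apply: eq_pd => // q; rewrite inE => Kq.
  by rewrite mul0r addr0 mul1r mulN1r; exact: fgh.
move=> Kp; split.
  apply: (aux eps (E_ i) (H_ (i + 2)) (H_ (i + 1)) _ _
    (C2E i) (C2H _) (C2H _)) => // q Kq.
  by have [] := maxwell_slab i q Kq.
apply: (aux mu (H_ i) (E_ (i + 1)) (E_ (i + 2)) _ _
  (C2H i) (C2E _) (C2E _)) => // q Kq.
by have [] := maxwell_slab i q Kq.
Qed.

Definition energy_density p : R :=
  eps * (\sum_i Ew i p ^+ 2) + mu * (\sum_i Hw i p ^+ 2).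

Definition energy_density_dt p : R :=
  \sum_i (2 * eps * pd None (Ew i) p * Ew i p + 2 * mu * pd None (Hw i) p * Hw i p).

(** Minus twice the Poynting vector of the differentiated fields, so that its
    divergence is the time derivative of [energy_density]. *)
Definition poynting_influx i p : R :=
  2 * (Ew (i + 2) p * Hw (i + 1) p - Ew (i + 1) p * Hw (i + 2) p).

Definition poynting_influx_dx i p : R :=
  2 * ((pd (Some i) (Ew (i + 2)) p * Hw (i + 1) p +
        Ew (i + 2) p * pd (Some i) (Hw (i + 1)) p) -
       (pd (Some i) (Ew (i + 1)) p * Hw (i + 2) p +
        Ew (i + 1) p * pd (Some i) (Hw (i + 2)) p)).

Lemma poynting_balance p : slab T p ->
  energy_density_dt p = \sum_i poynting_influx_dx i p.
Proof.
move=> Kp; rewrite /energy_density_dt.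
rewrite (eq_bigr (fun i : 'I_3 =>
  2 * (pd (Some (i + 1)) (Hw (i + 2)) p - pd (Some (i + 2)) (Hw (i + 1)) p) * Ew i p +
  2 * (pd (Some (i + 2)) (Ew (i + 1)) p - pd (Some (i + 1)) (Ew (i + 2)) p) * Hw i p)).
  rewrite /poynting_influx_dx; exact: (div_cross R (Ew ^~ p) (Hw ^~ p)
    (fun i j => pd (Some i) (Ew j) p) (fun i j => pd (Some i) (Hw j) p)).
move=> i _; have [<- <-] := pd_maxwell i p Kp.
move: (pd None (Ew i) p) (pd None (Hw i) p) (Ew i p) (Hw i p) => *; ring.
Qed.

(** No energy crosses a face. If the [w]-th axis is tangent to it, differentiating
    preserves the vanishing of the tangential electric components. If it is normal
    to it, the tangential components of the differentiated magnetic field vanish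
    instead. *)
Lemma poynting_influx_face i p : slab T p ->
  stcoord p (Some i) = 0 \/ stcoord p (Some i) = 1 -> poynting_influx i p = 0.
Proof.
move=> Kp h; have [b pb] : exists b : bool, stcoord p (Some i) = b%:R.
  by case: h => ->; [exists false|exists true].
rewrite /poynting_influx; have [iw|wi] := eqVneq w i.
  have [h1 h2] := PEC_normal_pd i b p Kp pb.
  by rewrite /Hw iw h1 h2 !mulr0 subrr mulr0.
have wi' : Some w != Some i by [].
have [h1 h2 _] := PEC_tangential_pd i b (Some w) p Kp pb wi'.
by rewrite /Ew h1 h2 !mul0r subrr mulr0.
Qed.

Let C1_Ew d i : C1_along T d (Ew i) (pd d (Ew i)).
Proof. exact: C2_C1_along_pd T0 (C2E i) (Some w) d. Qed.

Let C1_Hw d i : C1_along T d (Hw i) (pd d (Hw i)).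
Proof. exact: C2_C1_along_pd T0 (C2H i) (Some w) d. Qed.

Lemma poynting_influx_C1_along i :
  C1_along T (Some i) (poynting_influx i) (poynting_influx_dx i).
Proof.
have := C1_along_lin T _ _ _ _ _ 2 (-2)
  (C1_alongM T _ _ _ _ _ (C1_Ew (Some i) (i + 2)) (C1_Hw (Some i) (i + 1)))
  (C1_alongM T _ _ _ _ _ (C1_Ew (Some i) (i + 1)) (C1_Hw (Some i) (i + 2))).
apply: C1_along_eq => p; rewrite /poynting_influx /poynting_influx_dx.
  move: (Ew _ p) (Ew _ p) (Hw _ p) (Hw _ p) => *; ring.
move: (pd _ (Ew _) p) (pd _ (Ew _) p) (pd _ (Hw _) p) (pd _ (Hw _) p) => *.
by move: (Ew _ p) (Ew _ p) (Hw _ p) (Hw _ p) => *; ring.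
Qed.

Lemma energy_density_C1_along : C1_along T None energy_density energy_density_dt.
Proof.
have term i := C1_along_lin T _ _ _ _ _ eps mu
  (C1_alongM T _ _ _ _ _ (C1_Ew None i) (C1_Ew None i))
  (C1_alongM T _ _ _ _ _ (C1_Hw None i) (C1_Hw None i)).
apply: C1_along_eq (C1_along_sum T None _ _ term) => p.
  rewrite /energy_density !mulr_sumr -big_split.
  by apply: eq_bigr => i _; rewrite !expr2.
apply: eq_bigr => i _.
move: (pd None (Ew i) p) (pd None (Hw i) p) (Ew i p) (Hw i p) => *; ring.
Qed.

Lemma energy_conserved : exists c : R, forall t : R, 0 <= t <= T ->
  (\int[lebesgue3 R]_(X in @cube R) (energy_density (t, X))%:E = c%:E)%E.
Proof.
have [ce _ _] := energy_density_C1_along.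
pose I := (\int[lebesgue3_sf]_(X in @cube R) (energy_density (clamp T (0%R, X)))%:E)%E.
have fI : I \is a fin_num :=
  integrable_fin_num measurable_cube (integrable_clamped_at T T0 energy_density 0 ce).
exists (fine I) => t tT; apply: etrans (esym (fineK fI)).
exact: (integral_conserved T T0 energy_density energy_density_dt poynting_influx
  poynting_influx_dx t energy_density_C1_along poynting_influx_C1_along
  poynting_balance poynting_influx_face tT).
Qed.

End poynting.
End maxwell_system.

Theorem theorem2p1 (R : realType) (T eps mu : R)
    (E H : spacetime R -> 'rV[R]_3) :
  0 < T -> 0 < eps -> 0 < mu ->
  C2_field T E -> C2_field T H ->
  maxwell T eps mu E H -> PEC T E H ->
  forall w : 'I_3, exists c : R, forall t : R, 0 <= t <= T ->
    (\int[lebesgue3 R]_(X in @cube R)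
       (eps * enorm (pder T (Some w) E (t, X)) ^+ 2 +
        mu * enorm (pder T (Some w) H (t, X)) ^+ 2)%:E)%E = c%:E.
Proof.
move=> T0 _ _ C2E C2H MEH PEH w.
have [c hc] := energy_conserved T eps mu E H T0 C2E C2H MEH PEH w.
exists c => t tT; rewrite -(hc t tT); apply: eq_integral => X _.
have enormE (F : spacetime R -> 'rV[R]_3) (p : spacetime R) :
    enorm (pder T (Some w) F p) ^+ 2 = \sum_i pd T (Some w) (fun q => F q 0 i) p ^+ 2.
  rewrite /enorm sqr_sqrtr; last by apply: sumr_ge0 => i _; exact: sqr_ge0.
  by apply: eq_bigr => i _; rewrite mxE.
by rewrite !enormE.
Qed.
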